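(* Let $\kappa<\lambda$ be cardinals with $\kappa$ regular, $\tau$ a vocabulary, and $K_\lambda$ a family of $\tau$-models each of cardinality $\lambda$. Let $\varphi(\bar x,\bar y)$ be a formula (in any logic) with vocabulary $\subseteq\tau$, $\mathrm{lg}(\bar x)=\mathrm{lg}(\bar y)<\aleph_0$, which is asymmetric in every member of $K_\lambda$. Suppose that for every linear order $J$ of cardinality $\lambda$ there are $M\in K_\lambda$ and tuples $\bar a_s$ ($s\in J$) from $M$ such that $\langle\bar a_s:s\in J\rangle$ is weakly $(\kappa,\varphi(\bar x,\bar y))$-skeleton like inside $M$. Then $K_\lambda$ contains $2^\lambda$ pairwise non-isomorphic models.
   Context: Let $M$ be a structure, $I$ a linear order, $\bar a_s$ ($s\in I$) sequences from $M$ of a fixed length $\gamma$. For a set $\Lambda$ of formulas $\vartheta(\bar x,\bar b)$ ($\mathrm{lg}(\bar x)=\gamma$, parameters $\bar b$ from $M$), $\langle\bar a_s:s\in I\rangle$ is weakly $\kappa$-skeleton like inside $M$ for $\Lambda$ if for every $\vartheta(\bar x,\bar b)\in\Lambda$ there is $J\subseteq I$ with $|J|<\kappa$ such that whenever $s,t\in I$ have the same quantifier-free type over $J$ in $I$ (i.e. for every $r\in J$: $s<r\Leftrightarrow t<r$ and $s=r\Leftrightarrow t=r$), then $M\models\vartheta[\bar a_s,\bar b]\Leftrightarrow\vartheta[\bar a_t,\bar b]$. Let $\psi(\bar x,\bar y):=\varphi(\bar y,\bar x)$. $\varphi$ is asymmetric in $M$ if there are no $\bar a,\bar b\in{}^\gamma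 M$ with $M\models\varphi[\bar a,\bar b]\wedge\varphi[\bar b,\bar a]$. The sequence $\langle\bar a_s:s\in I\rangle$ is weakly $(\kappa,\varphi(\bar x,\bar y))$-skeleton like inside $M$ if $\varphi$ is asymmetric in $M$, $\langle\bar a_s:s\in I\rangle$ is weakly $\kappa$-skeleton like inside $M$ for the set of all formulas $\varphi(\bar x,\bar b),\psi(\bar x,\bar b)$ with $\bar b\in{}^\gamma M$, and for all $s,t\in I$: $M\models\varphi[\bar a_s,\bar a_t]$ iff $s<_I t$. *)

(* Defs.v *)
From mathcomp Require Import all_boot all_order.
From mathcomp Require Import boolp wochoice classical_sets functions cardinality.

Set Implicit Arguments.
Unset Strict Implicit.
Unset Printing Implicit Defensive.

Local Open Scope classical_set_scope.
Local Open Scope card_scope.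

(* A cardinal is represented by a type [K], standing for the cardinality of
   [[set: K]]. *)

Definition card_lt T U (A : set T) (B : set U) : Prop := A #<= B /\ A #!= B.

(* [R] is a (reflexive) well-order of [K] whose order type is an initial
   ordinal; [[set y | ~~ R x y]] is the set of strict predecessors of [x]. *)
Definition initial_well_order (K : Type) (R : rel K) : Prop :=
  well_order R /\ forall x, card_lt [set y | ~~ R x y] [set: K].

Definition cofinal (K : Type) (R : rel K) (X : set K) : Prop :=
  forall x, exists2 y, X y & R x y.

(* [K] is infinite and equal to its own cofinality, the cofinality being
   computed in an initial well-order of [K] (unique up to isomorphism). *)
Definition regular_cardinal (K : Type) : Prop :=
  infinite_set [set: K] /\
  exists R : rel K, initial_well_order R /\
    forall X : set K, cofinal R X -> X #= [set: K].

Record vocabulary := Vocabulary {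
  rsym : Type;
  rarity : rsym -> nat;
  fsym : Type;
  farity : fsym -> nat
}.

Record model (tau : vocabulary) := Model {
  carrier :> Type;
  rinterp : forall r : rsym tau, ('I_(rarity r) -> carrier) -> Prop;
  finterp : forall f : fsym tau, ('I_(farity f) -> carrier) -> carrier
}.
Arguments rinterp {tau} m r _.
Arguments finterp {tau} m f _.

Definition is_isomorphism (tau : vocabulary) (M N : model tau) (h : M -> N) :
    Prop :=
  [/\ bijective h,
      forall (r : rsym tau) (x : 'I_(rarity r) -> M),
        rinterp M r x <-> rinterp N r (h \o x)
    & forall (f : fsym tau) (x : 'I_(farity f) -> M),
        h (finterp M f x) = finterp N f (h \o x)].

Definition isomorphic (tau : vocabulary) (M N : model tau) : Prop :=
  exists h : M -> N, is_isomorphism h.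

(* The vocabulary consisting of the relation symbols in [A] and the function
   symbols in [B]. *)
Definition subvocabulary (tau : vocabulary) (A : set (rsym tau))
    (B : set (fsym tau)) : vocabulary :=
  @Vocabulary {r | A r} (fun r => rarity (proj1_sig r))
              {f | B f} (fun f => farity (proj1_sig f)).

Definition reduct (tau : vocabulary) (A : set (rsym tau)) (B : set (fsym tau))
    (M : model tau) : model (subvocabulary A B) :=
  @Model (subvocabulary A B) M
    (fun r => rinterp M (proj1_sig r)) (fun f => finterp M (proj1_sig f)).

(* An abstract logic: [formula sigma V] is the class of formulas of vocabulary
   [sigma] with free variables indexed by [V], [sat phi v] is satisfaction
   under the assignment [v]. The only requirement is that satisfaction be
   preserved by isomorphisms. *)
Record logic := Logic {
  formula : vocabulary -> Type -> Type;
  sat : forall (sigma : vocabulary) (V : Type),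
    formula sigma V -> forall M : model sigma, (V -> M) -> Prop;
  sat_isomorphism : forall (sigma : vocabulary) (V : Type)
    (phi : formula sigma V) (M N : model sigma) (h : M -> N) (v : V -> M),
    is_isomorphism h -> (sat phi v <-> sat phi (h \o v))
}.

(* A formula of [L] with vocabulary included in [tau]. *)
Record formula_in (L : logic) (tau : vocabulary) (V : Type) := FormulaIn {
  rvoc : set (rsym tau);
  fvoc : set (fsym tau);
  form :> formula L (subvocabulary rvoc fvoc) V
}.

Definition holds (L : logic) (tau : vocabulary) (V : Type)
    (phi : formula_in L tau V) (M : model tau) (v : V -> M) : Prop :=
  @sat L _ V phi (reduct (rvoc phi) (fvoc phi) M) v.

(* In [phi(x, y)] the variables [x_i] and [y_i] are [inl i] and [inr i], and
   [join_assign a b] assigns [a] to [x] and [b] to [y]. *)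
Definition join_assign (V W T : Type) (a : V -> T) (b : W -> T) (z : V + W) : T :=
  match z with inl i => a i | inr j => b j end.

(* A formula [theta(x, b)] with [x] indexed by [G] and parameters in [M]: a
   formula of [L], each free variable of which is replaced either by one of
   the [x_i] or by an element of [M]. *)
Record pformula (L : logic) (tau : vocabulary) (G : Type) (M : model tau) :=
  PFormula {
    pvars : Type;
    pform : formula_in L tau pvars;
    psubst : pvars -> G + M
  }.
Arguments psubst {L tau G M} p _.

Definition pholds (L : logic) (tau : vocabulary) (G : Type) (M : model tau)
    (theta : pformula L G M) (a : G -> M) : Prop :=
  holds (pform theta) (join_assign a id \o psubst theta).

Section SkeletonLike.
Context {L : logic} {tau : vocabulary} {G : Type}.
Implicit Types (M : model tau) (phi : formula_in L tau (G + G)).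

Definition asymmetric phi M : Prop :=
  ~ exists a b : G -> M,
      holds phi (join_assign a b) /\ holds phi (join_assign b a).

Definition phi_instance phi M (b : G -> M) : pformula L G M :=
  PFormula phi (join_assign inl (inr \o b)).

(* [psi(x, b)], where [psi(x, y) := phi(y, x)]. *)
Definition psi_instance phi M (b : G -> M) : pformula L G M :=
  PFormula phi (join_assign (inr \o b) inl).

Definition same_qf_type (d : Order.disp_t) (I : orderType d) (J : set I)
    (s t : I) : Prop :=
  forall r, J r -> ((s < r)%O <-> (t < r)%O) /\ (s = r <-> t = r).

Definition weakly_skeleton_like_for (K : Type) (d : Order.disp_t)
    (I : orderType d) M (Lambda : pformula L G M -> Prop) (a : I -> G -> M) :
    Prop :=
  forall theta, Lambda theta ->
    exists J : set I, card_lt J [set: K] /\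
      forall s t : I, same_qf_type J s t ->
        (pholds theta (a s) <-> pholds theta (a t)).

Definition weakly_skeleton_like (K : Type) phi (d : Order.disp_t)
    (I : orderType d) M (a : I -> G -> M) : Prop :=
  [/\ asymmetric phi M,
      weakly_skeleton_like_for K
        (fun theta => exists b : G -> M,
           theta = phi_instance phi b \/ theta = psi_instance phi b) a
    & forall s t : I, holds phi (join_assign (a s) (a t)) <-> (s < t)%O].

End SkeletonLike.

(* Main.v *)
Require Import Defs.
From HB Require Import structures.
From mathcomp Require Import all_boot all_order.
From mathcomp Require Import boolp wochoice classical_sets functions cardinality.

(* Write [P] for the relation defined by [phi] on [n]-tuples. In a sum, over a
   well-order [J], of reversed orders [G i], a cut at [i] with both sides of
   cofinality [>= kappa] cannot be crossed by any [P c _] or [P _ c]. Hence if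
   skeletons along two such sums are interleaved at the end, they are interleaved
   at the initial cuts of almost all their summands. Starting from the
   incompatibility of the cofinalities [kappa] and [kappa^+], this lets one code
   every [X] of [set lambda] in an order [O X] so that the skeletons along [O X]
   and [O Y], [X <> Y], are never interleaved: the coding goes by induction on
   initial segments of [lambda], using the coding of [X] below [i] as the [i]-th
   summand when the cofinality is [> kappa], and an Ulam partition of [kappa^+] in
   [kappa] stationary sets otherwise.

   To have only [lambda] many interleaving classes in a model of size [lambda],
   one uses cuts with asymmetric sides. Rank the tuples by the elements of
   [lambda]. Some cut has its left side cofinally of rank [< x] and its right
   side of cofinality [> |x|], so a single tuple far enough on the right side
   decides [P c _] near the cut for all [c] of rank [< x]. This tuple and [x] name
   the cut, and equal names imply interleaving. So every isomorphism class
   contains at most [lambda] of the [2^lambda] models, and a diagonal argument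
   yields [2^lambda] classes. *)

Set Implicit Arguments.
Unset Strict Implicit.
Unset Printing Implicit Defensive.

Local Open Scope classical_set_scope.
Local Open Scope card_scope.

(** * Cardinals and linear orders *)

Lemma card_leI T U (A : set T) (B : set U) (f : T -> U) :
  (forall x, A x -> B (f x)) ->
  (forall x y, A x -> A y -> f x = f y -> x = y) -> A #<= B.
Proof.
move=> fB finj; suff [g] : $|{injfun A >-> B}| by exact: inj_card_le g.
apply/injfunPex; exists f => //.
by move=> x y /set_mem Ax /set_mem Ay; apply: finj.
Qed.

Lemma card_leE T U (A : set T) (B : set U) : A #<= B -> B !=set0 ->
  exists f : T -> U, (forall x, A x -> B (f x)) /\
    forall x y, A x -> A y -> f x = f y -> x = y.
Proof.
move=> AB [b Bb]; move: AB => /card_leP[g].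
pose h x := if pselect (A x) is left Ax then val (g (SigSub (mem_set Ax))) else b.
exists h; split=> [x Ax|x y Ax Ay]; rewrite /h.
  by case: pselect => // ?; exact: set_valP.
case: pselect => // ?; case: pselect => // ?.
by move=> /val_inj /(inj (in_setT _) (in_setT _)) [].
Qed.

Record is_linorder (T : Type) (r : T -> T -> Prop) : Prop := IsLinorder {
  linorder_irr : forall x, ~ r x x;
  linorder_trans : forall y x z, r x y -> r y z -> r x z;
  linorder_total : forall x y, [\/ r x y, x = y | r y x]
}.

Record linorder := Linorder { car :> Type; lt : car -> car -> Prop; lt_linorder : is_linorder lt }.
Arguments lt {l} _ _.

Lemma lt_irr (I : linorder) (x : I) : ~ lt x x. Proof. exact: (linorder_irr (lt_linorder I)). Qed.
Lemma lt_trans (I : linorder) (y x z : I) : lt x y -> lt y z -> lt x z.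
Proof. exact: (linorder_trans (lt_linorder I)). Qed.
Lemma lt_total (I : linorder) (x y : I) : [\/ lt x y, x = y | lt y x].
Proof. exact: (linorder_total (lt_linorder I)). Qed.

Definition le (I : linorder) (x y : I) := ~ lt y x.
Lemma le_refl (I : linorder) (x : I) : le x x. Proof. exact: lt_irr. Qed.
Lemma ltW (I : linorder) (x y : I) : lt x y -> le x y.
Proof. by move=> xy yx; apply: (lt_irr (lt_trans xy yx)). Qed.
Lemma le_lt_trans (I : linorder) (y x z : I) : le x y -> lt y z -> lt x z.
Proof.
move=> xy yz; case: (lt_total x y) => [h|->//|//]; exact: lt_trans h yz.
Qed.
Lemma lt_le_trans (I : linorder) (y x z : I) : lt x y -> le y z -> lt x z.
Proof.
move=> xy yz; case: (lt_total y z) => [h|<-//|//]; exact: lt_trans xy h.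
Qed.
Lemma nleP (I : linorder) (x y : I) : ~ le x y -> lt y x. Proof. exact: contrapT. Qed.
Lemma le_trans (I : linorder) (y x z : I) : le x y -> le y z -> le x z.
Proof. by move=> xy yz zx; apply: yz; apply: (lt_le_trans zx). Qed.

Lemma le_max (I : linorder) (x y : I) : exists z, le x z /\ le y z.
Proof.
case: (pselect (lt x y)) => h; first by exists y; split; [exact: ltW|exact: le_refl].
by exists x; split; [exact: le_refl|].
Qed.

Definition seg (I : linorder) (x : I) : set I := [set y | lt y x].

Definition wellorder (I : linorder) :=
  forall A : set I, A !=set0 -> exists2 m, A m & forall x, A x -> le m x.

Lemma wf_well_founded (I : linorder) : wellorder I -> well_founded (@lt I).
Proof.
move=> wfI x; apply: contrapT => nx.
have [m /= nm mmin] := wfI [set y | ~ Acc lt y] (ex_intro _ x nx).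
by apply: nm; constructor => y ym; apply: contrapT => /mmin; apply.
Qed.

(** The recursion step sees the earlier values only as a set, which suffices for greedy
    constructions. *)
Lemma wf_rec (I : linorder) (U : Type) (Phi : set U -> U) : wellorder I ->
  exists f : I -> U, forall x, f x = Phi (f @` seg x).
Proof.
move=> /wf_well_founded wfI.
pose F x (rec : forall y : I, lt y x -> U) :=
  Phi [set u | exists y (h : lt y x), rec y h = u].
exists (Fix wfI (fun=> U) F) => x; rewrite Fix_eq.
  congr Phi; apply/seteqP; split=> u /=.
    by move=> [y [yx <-]]; exists y.
  by move=> [y yx <-]; exists y, yx.
move=> {}x f g fg; rewrite /F; congr Phi; apply/seteqP; split=> u /=.
  by move=> [y [yx <-]]; exists y, yx; rewrite fg.
by move=> [y [yx <-]]; exists y, yx; rewrite fg.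
Qed.

Lemma exists_pick (U : Type) (b : U) :
  exists g : set U -> U, forall A, A !=set0 -> A (g A).
Proof.
exists (fun A => if pselect (A !=set0) is left h then sval (cid h) else b) => A.
by case: pselect => // h _; case: (cid h).
Qed.

(** Greedy injection: send [x] to an element of [B] not yet used. The values on [seg x] cannot
    exhaust [B], or [B] would be no larger than [seg x]. *)
Lemma wf_embed (I : linorder) (D : set I) U (B : set U) : wellorder I ->
  (forall x, D x -> ~ (B #<= seg x)) -> D #<= B.
Proof.
move=> wfI DB.
case: (pselect (D !=set0)) => [[x0 Dx0]|/set0P/negP]; last first.
  by rewrite negbK => /eqP ->; exact: card_ge0.
have [b Bb] : B !=set0.
  apply/set0P/eqP => B0; apply: (DB _ Dx0); rewrite B0; exact: card_ge0.
have [g gP] := exists_pick b.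
have [f fE] := wf_rec (fun S => g (B `\` S)) wfI.
have fP x : D x -> (B `\` f @` seg x) (f x).
  move=> Dx; rewrite fE; apply: gP; apply: contrapT => nB.
  apply: (DB _ Dx); apply: (card_le_trans (B := f @` seg x)).
    by apply: subset_card_le => u Bu; apply: contrapT => nu; apply: nB; exists u.
  exact: card_image_le.
apply: (card_leI (f := f)) => [x /fP[]//|x y Dx Dy fxy].
case: (lt_total x y) => // h; exfalso.
  by have [_ /=] := fP _ Dy; apply; exists x.
by have [_ /=] := fP _ Dx; apply; exists y.
Qed.

(** All order axioms come from the unique minima of sets of at most three elements. *)
Lemma well_order_linorder (T : Type) (R : rel T) : well_order R ->
  exists h : is_linorder (fun x y => ~~ R y x), wellorder (Linorder h).
Proof.
move=> woR.
have minR (A : set T) : A !=set0 -> exists2 m, A m & forall x, A x -> R m x.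
  move=> [x Ax]; have [|m [[mA mlb] _]] := woR [pred x | `[< A x >]].
    by exists x; apply/asboolP.
  exists m; first exact/asboolP.
  by move=> y Ay; apply: mlb; apply/asboolP.
have Rxx x : R x x by have [|m -> h] := minR [set x]; [exists x|apply: h].
have Ranti x y : R x y -> R y x -> x = y.
  move=> xy yx; have [|m [_ um]] := woR [pred z | `[< z = x \/ z = y >]].
    by exists x; apply/asboolP; left.
  rewrite -(um x) ?(um y) //; split.
  - by apply/asboolP; right.
  - by move=> z /asboolP[] ->.
  - by apply/asboolP; left.
  - by move=> z /asboolP[] ->.
have Rtot x y : R x y \/ R y x.
  have [|m [] -> h] := minR [set x; y]; first by exists x; left.
  - by left; apply: h; right.
  - by right; apply: h; left.
have h : is_linorder (fun x y => ~~ R y x).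
  split.
  - by move=> x; rewrite Rxx.
  - move=> y x z xy yz; apply/negP => zx.
    have [|m [[|]|] -> h] := minR [set x; y; z]; first by exists x; left; left.
    + have xz : x = z by apply: Ranti => //; apply: h; right.
      by move: yz; rewrite -xz; case: (Rtot x y) xy => -> // /negP.
    + by move/negP: xy; apply; apply: h; left; left.
    + by move/negP: yz; apply; apply: h; left; right.
  - move=> x y; case xy: (R x y); last by constructor 3.
    case yx: (R y x); last by constructor 1.
    by constructor 2; apply: Ranti.
exists h => A /minR[m Am mA]; exists m => // x /mA mx; rewrite /le /=.
by rewrite mx.
Qed.

Lemma exists_wo (T : Type) :
  exists (r : T -> T -> Prop) (h : is_linorder r), wellorder (Linorder h).
Proof.
have [R /well_order_linorder[h hwf]] := @well_ordering_principle {classic T}.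
by exists (fun x y => ~~ R y x), h.
Qed.

Lemma card_le_neq0 T U (A : set T) (B : set U) : A #<= B -> A !=set0 -> B !=set0.
Proof.
move=> AB [a Aa]; apply: contrapT => nB; move: AB.
have -> : B = set0 by apply/seteqP; split=> // z Bz; apply: nB; exists z.
by move=> /card_le0P A0; rewrite A0 in Aa.
Qed.

Lemma card_le_total T U (B : set U) : [set: T] #<= B \/ B #<= [set: T].
Proof.
have [r [h wfr]] := exists_wo T.
case: (pselect (exists x : Linorder h, B #<= seg x)) => [[x Bx]|nB].
  by right; apply: (card_le_trans Bx); apply: card_leT.
by left; apply: (wf_embed (I := Linorder h)) => // x _ Bx; apply: nB; exists x.
Qed.

Lemma is_linorder_preim T (I : linorder) (f : T -> I) : injective f ->
  is_linorder (fun x y => lt (f x) (f y)).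
Proof.
move=> finj; split=> [x|y x z|x y]; [exact: lt_irr|exact: lt_trans|].
by case: (lt_total (f x) (f y)) => [|/finj|] h;
  [constructor 1|constructor 2|constructor 3].
Qed.

Definition preim_order T (I : linorder) (f : T -> I) (finj : injective f) : linorder :=
  Linorder (is_linorder_preim finj).

Lemma wf_preim T (I : linorder) (f : T -> I) (finj : injective f) :
  wellorder I -> wellorder (preim_order finj).
Proof.
move=> wfI A [a Aa]; have [|m [x Ax <-] h] := wfI (f @` A); first by exists (f a), a.
by exists x => // y Ay; apply: h; exists y.
Qed.

Lemma sval_injective T (A : T -> Prop) : injective (@proj1_sig T A).
Proof.
move=> [x Ax] [y Ay] /= xy; subst y; congr exist; exact: Prop_irrelevance.
Qed.

Definition sub_order (I : linorder) (A : set I) : linorder := preim_order (@sval_injective I A).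

Lemma is_linorder_rev (I : linorder) : is_linorder (fun x y : I => lt y x).
Proof.
split=> [x|y x z xy yz|x y]; [exact: lt_irr|exact: lt_trans yz xy|].
by case: (lt_total x y) => h; [constructor 3|constructor 2|constructor 1].
Qed.
Definition rev_order (I : linorder) : linorder := Linorder (is_linorder_rev I).

Section Sum.
Variables (J : linorder) (G : J -> linorder).

Definition sum_lt (u v : {i : J & G i}) : Prop :=
  lt (tag u) (tag v) \/
  exists e : tag u = tag v, lt (eq_rect _ G (tagged u) _ e) (tagged v).

Lemma sum_lt_same i (x y : G i) :
  sum_lt (existT _ i x) (existT _ i y) <-> lt x y.
Proof.
split=> [[/lt_irr//|[/= e]]|xy]; last by right; exists erefl.
by rewrite (Prop_irrelevance e erefl).
Qed.

Lemma is_linorder_sum : is_linorder sum_lt.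
Proof.
split.
- by move=> [i x] /sum_lt_same /lt_irr.
- move=> [j y] [i x] [k z] [/= ij|[/= e]].
    move=> [/= jk|[/= e _]]; left; [exact: lt_trans jk|by subst k].
  subst j => /= xy [/= ik|[/= e]]; first by left.
  by subst k => /= yz; right; exists erefl; exact: lt_trans yz.
- move=> [i x] [j y]; case: (lt_total i j) => [h|e|h].
  + by constructor 1; left.
  + subst j; case: (lt_total x y) => [h|->|h].
    * by constructor 1; apply/sum_lt_same.
    * by constructor 2.
    * by constructor 3; apply/sum_lt_same.
  + by constructor 3; left.
Qed.

Definition sum_order : linorder := Linorder is_linorder_sum.

Lemma wf_sum : wellorder J -> (forall i, wellorder (G i)) -> wellorder sum_order.
Proof.
move=> wfJ wfG A [[i x] Ax].
have [|m [y Ay] mmin] := wfJ [set j | exists y : G j, A (existT _ j y)].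
  by exists i, x.
have [|z Az zmin] := wfG m [set z | A (existT _ m z)]; first by exists y.
exists (existT _ m z) => // -[k t] At [/=|[/= e]].
  by apply: mmin; exists t.
by subst k => /=; apply: zmin.
Qed.

End Sum.

(** * Squares of infinite cardinals *)

Definition square_le T (A : set T) := A `*` A #<= A.

Lemma square_le_eq T U (A : set T) (B : set U) :
  A #<= B -> B #<= A -> square_le B -> square_le A.
Proof.
move=> AB BA sB; case: (pselect (A !=set0)) => [A0|nA]; last first.
  by apply: (card_leI (f := fst)) => p; last move=> q; case=> Ap _ //; case: nA; exists p.1.
have [f [fB finj]] := card_leE AB (card_le_neq0 AB A0).
apply: (card_le_trans _ BA); apply: (card_le_trans _ sB).
apply: (card_leI (f := fun p => (f p.1, f p.2))) => [[x y] [/= Ax Ay]|].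
  by split; apply: fB.
by move=> [x y] [x' y'] [/= Ax Ay] [/= Ax' Ay'] [/finj-> // /finj->].
Qed.

(** Hilbert's hotel along a copy [g] of the naturals in [A]: a new [m] moves to [g 0] and each [g n]
    to [g n.+1]. *)
Lemma infinite_setU1 T (A : set T) (m : T) : infinite_set A -> m |` A #<= A.
Proof.
move=> infA; have [|g [gA ginj]] := card_leE ((infiniteP A).1 infA) _.
  exact: infinite_setN0.
case: (pselect (A m)) => Am.
  by apply: subset_card_le => x [->|].
pose h x := if pselect (x = m) is left _ then g 0%N else
  if pselect (exists n, x = g n) is left e then g (sval (cid e)).+1 else x.
apply: (card_leI (f := h)) => [x|x y].
  rewrite /h; case: pselect => [_ _|xm]; first exact: gA.
  by case: pselect => [e _|_ [|//]]; first exact: gA.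
have gE n p : g n = g p -> n = p by move=> e; apply: ginj.
rewrite /h; case: (pselect (x = m)) => [->|xm] Ax;
  case: (pselect (y = m)) => [->|ym] Ay //.
- case: pselect => [e|ne]; first by move/gE.
  by move=> e; case: ne; exists 0%N.
- case: pselect => [e|ne]; first by move/gE.
  by move=> e; case: ne; exists 0%N.
case: pselect => [[n xe]|nx]; case: pselect => [[p ye]|ny].
- case: cid => /= n' xe'; case: cid => /= p' ye' /gE[e].
  by rewrite xe' ye' e.
- by move=> e; case: ny; rewrite -e; eexists.
- by move=> e; case: nx; rewrite e; eexists.
- by [].
Qed.

Section Square.
Variable (I : linorder).
Hypothesis wfI : wellorder I.

(** Goedel's well-order of pairs: first by maximum, then lexicographically. The predecessors of a
    pair thus lie in the square of an initial segment. *)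
Let pair_order : linorder := sum_order (fun _ : I => sum_order (fun _ : I => I)).

Let max (x y : I) := if pselect (lt x y) then y else x.

Let code (p : I * I) : pair_order :=
  existT (fun=> sum_order (fun _ : I => I)) (max p.1 p.2) (existT (fun=> car I) p.1 p.2).

Let code_inj : injective code.
Proof.
move=> [x y] [x' y'] /(f_equal (fun z : pair_order => tagged z)) /= e.
move: (f_equal (fun z : {_ : I & I} => tag z) e) => /= ->.
by move: (f_equal (fun z : {_ : I & I} => tagged z) e) => /= ->.
Qed.

Let sq := preim_order code_inj.

Let wf_sq : wellorder sq.
Proof. by apply: wf_preim; apply: wf_sum => // _; apply: wf_sum. Qed.

Let le_maxs (x y : I) : le x (max x y) /\ le y (max x y).
Proof.
rewrite /max; case: pselect => h; split; do ?exact: le_refl; first exact: ltW.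
exact: h.
Qed.

Let seg_sq (p q : sq) : lt q p -> le q.1 (max p.1 p.2) /\ le q.2 (max p.1 p.2).
Proof.
have [q1 q2] := le_maxs q.1 q.2; case=> [/= h|[/= e _]].
  by split; apply: ltW; [apply: le_lt_trans q1 h|apply: le_lt_trans q2 h].
by split; [rewrite -e|rewrite -e].
Qed.

(** If [B] has the size of some [seg y] with [y] in [B], the hypothesis on that segment applies.
    Otherwise [B] has no largest element, so the predecessors of a pair lie in the square of some
    [seg z] with [z] in [B], which has no room for a copy of [B]. *)
Lemma square_le_step (B : set I) :
  (forall x y, B y -> lt x y -> B x) -> infinite_set B ->
  (forall y, B y -> infinite_set (seg y) -> square_le (seg y)) -> square_le B.
Proof.
move=> downB infB IH.
case: (pselect (exists2 y, B y & B #<= seg y)) => [[y By Bley]|nB].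
  have yB : seg y #<= B by apply: subset_card_le => x; apply: downB.
  apply: (square_le_eq Bley yB); apply: IH => // fy; apply: infB.
  exact: card_le_finite fy.
have nomax m : B m -> exists2 y, B y & lt m y.
  move=> Bm; apply: contrapT => nm; apply: nB; exists m => //.
  have BE : B `<=` m |` seg m.
    move=> x Bx; case: (lt_total x m) => [h|->|h]; [by right|by left|].
    by case: nm; exists x.
  apply: (card_le_trans (subset_card_le BE)); apply: infinite_setU1 => fm.
  apply: infB; apply: (sub_finite_set BE); by rewrite finite_setU.
apply: (wf_embed (I := sq)) => // -[x y] [/= Bx By] Ble.
have Bm : B (max x y) by rewrite /max; case: pselect.
have [z Bz mz] := nomax _ Bm.
have sub : (seg (I := sq) (x, y)) `<=` seg z `*` seg z.
  by move=> q /seg_sq/= [h1 h2]; split; apply: le_lt_trans mz.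
apply: nB; exists z => //.
apply: (card_le_trans Ble); apply: (card_le_trans (subset_card_le sub)).
apply: IH => // fz; apply: infB; apply: (card_le_finite Ble).
by apply: (sub_finite_set sub); apply: finite_setX.
Qed.

Lemma square_le_seg (x : I) : infinite_set (seg x) -> square_le (seg x).
Proof.
move: x; apply: (well_founded_ind (wf_well_founded wfI)) => x IH infx.
by apply: square_le_step => // y z zx yz; apply: lt_trans zx.
Qed.

Lemma square_le_setT : infinite_set [set: I] -> square_le [set: I].
Proof.
by move=> infI; apply: square_le_step => // y _; apply: square_le_seg.
Qed.

End Square.

Lemma card_square T : infinite_set [set: T] -> [set: T * T] #<= [set: T].
Proof.
have [r [h wfr]] := exists_wo T => /(square_le_setT wfr) H.
by apply: card_le_trans H; apply: subset_card_le.
Qed.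

Lemma card_sig T (A : set T) : [set: {x | A x}] #= A.
Proof.
apply/card_eqPle; split.
  by apply: (card_leI (f := sval)) => [[]//|? ? _ _ /sval_injective].
case: (pselect (A !=set0)) => [[a Aa]|nA]; last first.
  have -> : A = set0 by apply/seteqP; split=> // x Ax; apply: nA; exists x.
  exact: card_ge0.
apply: (card_leI (f := fun x => if pselect (A x) is left h then exist _ x h
  else exist _ a Aa)) => // x y Ax Ay.
by case: pselect => // ?; case: pselect => // ? [].
Qed.

Lemma card_square_set T (A : set T) : infinite_set A -> square_le A.
Proof.
move=> infA; have /card_eqPle[e1 e2] := card_sig A.
apply: (square_le_eq e2 e1); apply: card_le_trans (subset_card_le _) _; last first.
  apply: card_square => fA; apply: infA; exact: card_le_finite e2 fA.
by [].
Qed.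

(** If some segment of [r] has the size of [T], pull [r] back along an injection of [T] into the
    least such segment. *)
Lemma exists_initial_wo (T : Type) :
  exists (r : T -> T -> Prop) (h : is_linorder r), wellorder (Linorder h) /\
    forall x : Linorder h, ~ ([set: T] #<= seg x).
Proof.
have [r [h wfr]] := exists_wo T.
case: (pselect (exists x : Linorder h, [set: T] #<= seg x)) => [ex|nex]; last first.
  by exists r, h; split=> // x Tx; apply: nex; exists x.
have [x Tx xmin] := wfr _ ex.
have [|f [fx finj]] := card_leE Tx _; first by apply: (card_le_neq0 Tx); exists x.
have finj' : injective (f : T -> Linorder h) by move=> a b; apply: finj.
exists (fun a b => r (f a) (f b)), (is_linorder_preim finj').
split=> [|a Ta]; first exact: (wf_preim (finj := finj') wfr).
apply: (xmin (f a)); last by apply: fx.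
apply: (card_le_trans Ta); apply: (card_leI (f := f)) => // b c _ _.
exact: finj'.
Qed.

(** * Cofinality and stationary sets *)

Section Kappa.
Variable K : linorder.
Hypothesis wfK : wellorder K.
Hypothesis infK : infinite_set [set: K].

(* The type [K] plays the role of the regular cardinal [kappa]: [small] means of
   cardinality [< kappa], and [kdir I] that [I] is nonempty of cofinality
   [>= kappa]. *)
Definition small T (D : set T) := card_lt D [set: K].

Definition kdir (I : linorder) :=
  forall D : set I, small D -> exists u, forall d, D d -> lt d u.

Definition kbound (I : linorder) :=
  forall D : set I, D #<= [set: K] -> exists u, forall d, D d -> lt d u.

Definition kdir_below (I : linorder) (x : I) :=
  forall D : set I, small D -> D `<=` seg x ->
  exists2 u, lt u x & forall d, D d -> lt d u.

(* A weak form of closure under [tau], meant for [x] of cofinality [>= kappa];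
   it is enough to run the club arguments below and, unlike honest clubs, it
   makes sense in a well-order [I] of singular cardinality. *)
Definition closed_at (I : linorder) (tau : I -> I) (x : I) :=
  forall j, lt j x -> exists2 j', le j j' & lt j' x /\ lt (tau j') x.

Definition stationary (I : linorder) (A : set I) :=
  forall tau, exists2 x, A x & kdir_below x /\ closed_at tau x.

Hypothesis dirK : kdir K.

Lemma smallP T (D : set T) : small D <-> ~ ([set: K] #<= D).
Proof.
split=> [[DK nDK] KD|nKD].
  by move: nDK; rewrite (_ : D #= [set: K]) //; apply/card_eqPle.
have DK : D #<= [set: K] by case: (card_le_total K D).
by split=> //; apply/negP => /card_eqPle[].
Qed.

Lemma small_le T U (A : set T) (B : set U) : A #<= B -> small B -> small A.
Proof.
by move=> AB /smallP nB; apply/smallP => KA; apply/nB/(card_le_trans KA).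
Qed.

Lemma small_finite T (D : set T) : finite_set D -> small D.
Proof. by move=> fD; apply/smallP => KD; apply: infK; apply: card_le_finite fD. Qed.

Lemma kbound_kdir (I : linorder) : kbound I -> kdir I.
Proof. by move=> bI D [DK _]; apply: bI. Qed.

Lemma kdir_inhab (I : linorder) : kdir I -> [set: I] !=set0.
Proof. by move=> dI; have [|u _] := dI set0; [apply: small_finite|exists u]. Qed.

Lemma kdir_nomax (I : linorder) (x : I) : kdir I -> exists y, lt x y.
Proof.
move=> dI; have [|u h] := dI [set x]; first exact: small_finite.
by exists u; apply: h.
Qed.

Lemma le_exists_gt (I : linorder) (x y : I) : kdir I -> exists2 z, lt x z & lt y z.
Proof.
move=> dI; have [z [xz yz]] := le_max x y; have [w zw] := kdir_nomax z dI.
by exists w; apply: le_lt_trans zw.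
Qed.

Lemma card_range_le T U (f : T -> U) : range f #<= [set: T].
Proof. exact: card_image_le. Qed.

(** Recursion on [K]: the at most [kappa] many earlier values and their images by [tau] are bounded,
    and the next value is an element of [B] above the bound. *)
Lemma unbounded_sequence (I : linorder) (B : set I) (tau : I -> I) : kbound I ->
  (forall u, exists2 b, B b & lt u b) ->
  exists f : K -> I, (forall xi, B (f xi)) /\
    forall eta xi, lt eta xi -> lt (f eta) (f xi) /\ lt (tau (f eta)) (f xi).
Proof.
move=> bI unB; have [i0 _] := kdir_inhab (kbound_kdir bI).
have [g gP] := exists_pick i0.
pose next S := B `&` [set b | forall s, S s -> lt s b /\ lt (tau s) b].
have [f fE] := wf_rec (fun S => g (next S)) wfK.
have fP xi : next (f @` seg xi) (f xi).
  rewrite fE; apply: gP.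
  have sK T (h : T -> I) (D : set T) : D #<= [set: K] -> h @` D #<= [set: K].
    by move=> DK; apply: card_le_trans DK; apply: card_image_le.
  have segK : seg xi #<= [set: K] by apply: card_leT.
  have [u1 hu1] := bI _ (sK _ f _ segK).
  have [u2 hu2] := bI _ (sK _ (tau \o f) _ segK).
  have [z u1z u2z] := le_exists_gt u1 u2 (kbound_kdir bI).
  have [b Bb zb] := unB z.
  exists b; split=> // _ [eta etaxi <-]; split.
    by apply: lt_trans zb; apply: lt_trans u1z; apply: hu1; exists eta.
  by apply: lt_trans zb; apply: lt_trans u2z; apply: hu2; exists eta.
exists f; split=> [xi|eta xi etaxi]; first by have [] := fP xi.
by have [_ /= h] := fP xi; apply: h; exists eta.
Qed.

(** The supremum of an increasing sequence of length [kappa] closed under [tau] is the required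
    point; regularity of [kappa] gives [kdir_below]. *)
Lemma stat_setT (I : linorder) : wellorder I -> kbound I -> stationary [set: I].
Proof.
move=> wfI bI tau.
have [|f [_ fP]] := unbounded_sequence (B := setT) tau bI.
  by move=> u; have [v uv] := kdir_nomax u (kbound_kdir bI); exists v.
have [|x /= fx xmin] := wfI [set u | forall xi, lt (f xi) u].
  by have [u hu] := bI _ (card_range_le f); exists u => xi; apply: hu; exists xi.
have below j : lt j x -> exists xi, le j (f xi).
  move=> jx; apply: contrapT => nj; apply: (xmin j) jx => xi.
  by apply: nleP => h; apply: nj; exists xi.
exists x => //; split.
  move=> D sD Dx; have [k0 _] := kdir_inhab dirK.
  have /choice[h hP] : forall d, exists xi, D d -> le d (f xi).
    move=> d; case: (pselect (D d)) => [Dd|nDd]; last by exists k0.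
    by have [xi ?] := below _ (Dx _ Dd); exists xi.
  have [xi hxi] := dirK (small_le (card_image_le h D) sD).
  exists (f xi); first exact: fx.
  move=> d Dd; apply: le_lt_trans (hP _ Dd) _.
  by have [] := fP (h d) xi (hxi _ (ex_intro2 _ _ d Dd erefl)).
move=> j /below[xi jxi]; have [xi' h] := kdir_nomax xi dirK.
exists (f xi) => //; split; first exact: fx.
by apply: lt_trans (fx xi'); have [] := fP _ _ h.
Qed.

Lemma stat_mono (I : linorder) (A B : set I) : A `<=` B -> stationary A -> stationary B.
Proof. by move=> AB sA tau; have [x Ax h] := sA tau; exists x => //; apply: AB. Qed.

Lemma closed_at_le (I : linorder) (tau tau' : I -> I) (x : I) :
  (forall j, le (tau j) (tau' j)) -> closed_at tau' x -> closed_at tau x.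
Proof.
move=> h c j jx; have [j' jj' [j'x tj']] := c j jx.
by exists j' => //; split=> //; apply: le_lt_trans tj'.
Qed.

Lemma kdir_below_inhab (I : linorder) (x : I) : kdir_below x -> exists j, lt j x.
Proof.
by move=> h; have [||u ux _] := h set0; [apply: small_finite| |exists u].
Qed.

Lemma closed_at_gt (I : linorder) (tau : I -> I) (a x : I) :
  kdir_below x -> closed_at tau x -> (forall j, le a (tau j)) -> lt a x.
Proof.
move=> /kdir_below_inhab[j jx] c h; have [j' _ [_ t]] := c j jx.
exact: le_lt_trans t.
Qed.

Lemma unbounded_fiber (I : linorder) (q : I -> K) : kbound I ->
  exists xi, forall u, exists2 a, q a = xi & lt u a.
Proof.
move=> bI; apply: contrapT => nxi.
have /choice[u uP] : forall xi, exists u, forall a, q a = xi -> ~ lt u a.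
  move=> xi; apply: contrapT => nu; apply: nxi; exists xi => u.
  by apply: contrapT => na; apply: nu; exists u => a qa ua; apply: na; exists a.
have [v vP] := bI _ (card_range_le u).
by apply: (uP (q v) v erefl); apply: vP; exists (q v).
Qed.

(* Ulam's matrix argument *)
Lemma stat_partition (I : linorder) : wellorder I -> kbound I ->
  (forall x : I, seg x #<= [set: K]) ->
  exists p : I -> K, forall xi, stationary [set x | p x = xi].
Proof.
move=> wfI bI segK; have dI := kbound_kdir bI.
have [k0 _] := kdir_inhab dirK.
(* [e x] injects the predecessors of [x] into [K]; the pairs [(a, xi)] index the entries of Ulam's
   matrix. *)
have /choice[e eP] : forall x : I, exists e : I -> K, forall a b,
    lt a x -> lt b x -> e a = e b -> a = b.
  by move=> x; have [|e [_ h]] := card_leE (segK x); [exists k0|exists e].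
(* Some entry in row [a] is stationary: otherwise a pointwise bound [sup] of the [kappa] many
   counterexamples [tau xi] has a closed point [x], which contradicts the choice of
   [tau (e x a)]. *)
have /choice[q qP] : forall a : I, exists xi, stationary [set x | lt a x /\ e x a = xi].
  move=> a; apply: contrapT => nst.
  have /choice[tau tauP] : forall xi, exists tau : I -> I, forall x,
      lt a x -> e x a = xi -> ~ (kdir_below x /\ closed_at tau x).
    move=> xi; apply: contrapT => ntau; apply: nst; exists xi => tau.
    apply: contrapT => nx; apply: ntau; exists tau => x ax ex h.
    by apply: nx; exists x.
  have /choice[sup supP] : forall j, exists u, lt a u /\ forall xi, lt (tau xi j) u.
    move=> j; have [u hu] := bI _ (card_range_le (tau ^~ j)).
    have [z az uz] := le_exists_gt a u dI.
    by exists z; split=> // xi; apply: lt_trans uz; apply: hu; exists xi.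
  have [x _ [dx cx]] := stat_setT wfI bI sup.
  have ax : lt a x.
    by apply: (closed_at_gt dx cx) => j; apply: ltW; have [] := supP j.
  apply: (tauP (e x a) x ax erefl); split=> //; apply: closed_at_le cx => j.
  by apply: ltW; have [_] := supP j.
have [xi0 unb] := unbounded_fiber q bI.
have [f [qf fP]] := unbounded_sequence (B := [set a | q a = xi0]) id bI unb.
have finj : injective f.
  move=> a b fab; case: (lt_total a b) => // /fP[h _]; exfalso;
  by move: h; rewrite fab; apply: lt_irr.
(* Entries with the same [xi0] and distinct [a] are disjoint because [e x] is injective, so [p] is
   well defined; [k0] is its value off their union. *)
have /choice[p pP] : forall x, exists eta : K,
    forall eta', lt (f eta') x -> e x (f eta') = xi0 -> eta = eta'.
  move=> x; case: (pselect (exists2 eta, lt (f eta) x & e x (f eta) = xi0)).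
    move=> [eta h1 h2]; exists eta => eta' h1' h2'; apply: finj.
    by apply: (eP x) => //; rewrite h2.
  by move=> n; exists k0 => eta' h1 h2; case: n; exists eta'.
exists p => xi; apply: (stat_mono (A := [set x | lt (f xi) x /\ e x (f xi) = xi0])).
  by move=> x [h1 h2]; apply: pP.
by rewrite -(qf xi); apply: qP.
Qed.

(** * Successor cardinals *)

Section Succ.
Variable L : linorder.
Hypothesis wfL : wellorder L.
Variables (U : Type) (N : set U).
Hypothesis infN : infinite_set N.
Hypothesis nLN : ~ ([set: L] #<= N).

(* The initial segment of [L] representing the successor cardinal of [N]. *)
Definition succ_order : linorder := sub_order (fun x : L => seg x #<= N).

Lemma wf_succ : wellorder succ_order. Proof. exact: wf_preim. Qed.

Lemma succ_seg (x : succ_order) : seg x #<= N.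
Proof.
apply: card_le_trans (proj2_sig x).
by apply: (card_leI (f := sval)) => // a b _ _; apply: sval_injective.
Qed.

Lemma finite_le_infinite T (A : set T) : finite_set A -> A #<= N.
Proof.
move=> [n An]; apply: card_le_trans ((infiniteP N).1 infN).
by move/card_eqPle: An => [An _]; apply: (card_le_trans An); apply: subset_card_le.
Qed.

(** Successor cardinals are regular. An unbounded [D] would make [succ_order] a union of at most [N]
    many sets of size at most [N], hence no larger than [N]. Then the least point of [L] outside it
    would have to belong to it, or else [L] itself would be no larger than [N]. *)
Lemma succ_bound (D : set succ_order) : D #<= N ->
  exists u, forall d, D d -> lt d u.
Proof.
move=> DN; apply: contrapT => nu.
have N0 : N !=set0 by apply: infinite_setN0.
pose A := [set x : L | seg x #<= N].
suff SN : [set: succ_order] #<= N.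
  have /card_eqPle[_ AS] := card_sig A; have AN := card_le_trans AS SN.
  case: (pselect (exists y : L, ~ A y)) => [/wfL[y nAy ymin]|nA].
    apply: nAy; rewrite /A /=; apply: card_le_trans AN; apply: subset_card_le => x xy.
    by apply: contrapT => /ymin; apply.
  apply: nLN; apply: card_le_trans AN; apply: subset_card_le => x _.
  by apply: contrapT => nAx; apply: nA; exists x.
have [j [jN jinj]] := card_leE DN N0.
have csegN (d : succ_order) : sval d |` seg (sval d) #<= N.
  case: (pselect (finite_set (seg (sval d)))) => fd.
    apply: finite_le_infinite; rewrite finite_setU; split=> //; exact: finite_set1.
  exact: card_le_trans (infinite_setU1 _ fd) (proj2_sig d).
have /choice[h hP] : forall x : succ_order, exists d, D d /\ le x d.
  move=> x; apply: contrapT => nd; apply: nu; exists x => d Dd.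
  by apply: nleP => xd; apply: nd; exists d.
have /choice[i iP] : forall d : succ_order, exists i : L -> U,
    (forall x, (sval d |` seg (sval d)) x -> N (i x)) /\
    forall x y, (sval d |` seg (sval d)) x -> (sval d |` seg (sval d)) y ->
      i x = i y -> x = y.
  by move=> d; have [i] := card_leE (csegN d) N0; exists i.
apply: card_le_trans (card_square_set infN).
have cs x : (sval (h x) |` seg (sval (h x))) (sval x).
  have [_ xd] := hP x; case: (lt_total (sval x) (sval (h x))) => [c|c|//];
  by [right|left].
apply: (card_leI (f := fun x => (j (h x), i (h x) (sval x)))).
  move=> x _; split; first by apply: jN; have [] := hP x.
  by have [iN _] := iP (h x); apply: iN.
move=> x y _ _ [/jinj hxy ixy]; apply: sval_injective.
have {}hxy : h x = h y by apply: hxy; [have [] := hP x|have [] := hP y].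
have [_ iinj] := iP (h x); apply: iinj => //; first by rewrite hxy.
by rewrite ixy hxy.
Qed.
End Succ.

(** * Skeletons and interleaving *)

Definition same_cut (I : linorder) (D : set I) (s t : I) :=
  forall r, D r -> (lt s r <-> lt t r) /\ (s = r <-> t = r).

Record skeleton T (P : T -> T -> Prop) (I : linorder) (a : I -> T) : Prop := Skeleton {
  skeleton_lt : forall s t, P (a s) (a t) <-> lt s t;
  skeleton_l : forall c, exists2 D, small D &
    forall s t, same_cut D s t -> (P (a s) c <-> P (a t) c);
  skeleton_r : forall c, exists2 D, small D &
    forall s t, same_cut D s t -> (P c (a s) <-> P c (a t))
}.

Definition asym T (P : T -> T -> Prop) := forall x y, P x y -> ~ P y x.
(** On a reversed summand, a skeleton for [P] becomes one for the converse relation. *)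
Definition dual T (P : T -> T -> Prop) := fun x y => P y x.

(* [P] is not assumed to be transitive, so that "[a] and [b] converge to the
   same cut" has to be expressed in this form. *)
Definition half_interleaved T (P : T -> T -> Prop) (I J : linorder) (a : I -> T) (b : J -> T) :=
  forall s0, exists2 s, le s0 s & exists t0, forall t, lt t0 t -> P (a s) (b t).

Definition interleaved T (P : T -> T -> Prop) (I J : linorder) (a : I -> T) (b : J -> T) :=
  half_interleaved P a b /\ half_interleaved P b a.

Definition separated (I J : linorder) :=
  forall T (P : T -> T -> Prop) (a : I -> T) (b : J -> T),
    asym P -> skeleton P a -> skeleton P b -> ~ interleaved P a b.

Lemma separated_sym (I J : linorder) : separated I J -> separated J I.
Proof. by move=> s T P a b aP sa sb [h1 h2]; apply: (s T P b a aP sb sa). Qed.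

Lemma asym_dual T (P : T -> T -> Prop) : asym P -> asym (dual P).
Proof. by move=> aP x y h1 h2; apply: (aP _ _ h1 h2). Qed.

(** * Sums of reversed orders and their cuts *)

Section SumRev.
Variables (J : linorder) (G : J -> linorder).

(* The point of reversing the summands is that the initial cut of the [i]-th
   summand has [J] below [i] on its left and [G i] on its right. *)
Definition sumrev : linorder := sum_order (fun i => rev_order (G i)).

Definition inj_at (i : J) (x : G i) : sumrev := existT _ i x.

Lemma lt_inj_at (i : J) (x y : G i) : lt (inj_at x) (inj_at y) <-> lt y x.
Proof. exact: (@sum_lt_same J (fun i => rev_order (G i))). Qed.

Lemma lt_tag (s t : sumrev) : lt (tag s) (tag t) -> lt s t.
Proof. by left. Qed.

Lemma le_tag (s t : sumrev) : le s t -> le (tag s) (tag t).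
Proof. by move=> h1 /lt_tag. Qed.

Lemma inj_at_inj (i : J) : injective (@inj_at i).
Proof.
by move=> x y e; case: (lt_total x y) => // /lt_inj_at; rewrite e => /lt_irr.
Qed.

Lemma sumrev_bound (D : set sumrev) : (forall i, [set: G i] !=set0) ->
  (exists u, forall d, (tag @` D) d -> lt d u) -> exists u, forall d, D d -> lt d u.
Proof.
move=> G0 [u hu]; have [g _] := G0 u; exists (inj_at g) => d Dd.
by apply: lt_tag; apply: hu; exists d.
Qed.

Lemma kdir_sumrev : kdir J -> (forall i, [set: G i] !=set0) -> kdir sumrev.
Proof.
move=> dJ G0 D sD; apply: sumrev_bound => //; apply: dJ.
by apply: small_le sD; apply: card_image_le.
Qed.

Lemma card_sumrev U (N : set U) : infinite_set N ->
  [set: J] #<= N -> (forall i, [set: G i] #<= N) -> [set: sumrev] #<= N.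
Proof.
move=> infN JN GN; have N0 := infinite_setN0 infN.
have [j [jN jinj]] := card_leE JN N0.
have gP i := cid (card_leE (GN i) N0).
apply: card_le_trans (card_square_set infN).
apply: (card_leI (f := fun s : sumrev => (j (tag s), sval (gP (tag s)) (tagged s)))).
  by move=> s _; split; [apply: jN|case: (gP (tag s)) => /= g [h _]; apply: h].
move=> [i x] [k y] _ _ [/jinj/= ik]; have {}ik := ik I I; subst k.
by case: (gP i) => /= g [_ h] /h -> .
Qed.

(** Points of [D] outside the summand do not distinguish its points, so the trace of [D] is
    enough. *)
Lemma skeleton_block T (P : T -> T -> Prop) (a : sumrev -> T) (i : J) :
  skeleton P a -> skeleton (dual P) (fun x : G i => a (inj_at x)).
Proof.
move=> [alt al ar].
have D'P (D : set sumrev) : small D -> exists2 D' : set (G i), small D' &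
    forall x y, same_cut D' x y -> same_cut D (inj_at x) (inj_at y).
  move=> sD; exists [set x | D (inj_at x)].
    by apply: small_le sD; apply: (card_leI (f := @inj_at i)) => // x y _ _ /inj_at_inj.
  move=> x y xy [k z] Dr; case: (lt_total i k) => [h|e|h].
  - have lr (w : G i) : lt (inj_at w) (existT _ k z) by apply: lt_tag.
    split; first by split=> _; apply: lr.
    by split=> e; [have := lr x|have := lr y]; rewrite e => /lt_irr.
  - subst k; have [h1 h2] := xy z Dr.
    (* [same_cut] records only [lt s r] and [s = r]; the reversal asks for [lt r s], which is
       recovered by totality. *)
    have gt (v w u : G i) : (lt w u -> lt v u) -> (w = u -> v = u) ->
        lt u v -> lt u w.
      move=> wv ewv zv; case: (lt_total w u) => // [/wv vz|/ewv vz].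
        by have := lt_trans zv vz => /lt_irr.
      by move: zv; rewrite vz => /lt_irr.
    split; last by split=> /inj_at_inj e; congr inj_at; apply/h2.
    split=> /lt_inj_at h; apply/lt_inj_at.
      exact: (gt x y z h1.2 h2.2 h).
    exact: (gt y x z h1.1 h2.1 h).
  - have gr (w : G i) : lt (existT _ k z : sumrev) (inj_at w) by apply: lt_tag.
    split; first by split=> e; [have := lt_trans e (gr x)|have := lt_trans e (gr y)] => /lt_irr.
    by split=> e; [have := gr x|have := gr y]; rewrite e => /lt_irr.
split=> [x y|c|c].
- by split=> [/alt/lt_inj_at//|h]; apply/alt/lt_inj_at.
- have [D /D'P[D' sD' h] hD] := ar c; exists D' => // x y /h; exact: hD.
- have [D /D'P[D' sD' h] hD] := al c; exists D' => // x y /h; exact: hD.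
Qed.

Section Cut.
Variable d : J.
Hypothesis dird : kdir_below d.
Hypothesis dirG : kdir (G d).

(** A neighbourhood of the initial cut of the [d]-th summand; by the reversal, the points of that
    summand close to the cut are the large [x]. *)
Definition near (j0 : J) (x0 : G d) (s : sumrev) :=
  lt j0 (tag s) /\ lt (tag s) d \/ exists2 x, s = inj_at x & lt x0 x.

(** Both sides of the cut have cofinality at least [kappa], so the small set [D] misses a
    neighbourhood of the cut. *)
Lemma cut_stable (D : set sumrev) : small D -> exists2 j0, lt j0 d & exists x0,
  forall s t, near j0 x0 s -> near j0 x0 t -> same_cut D s t.
Proof.
move=> sD.
have [||j0 j0d hj0] := dird (D := [set j | lt j d /\ exists2 r, D r & tag r = j]).
- apply: small_le sD; apply: card_le_trans (card_image_le (fun s : sumrev => tag s) D).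
  by apply: subset_card_le => j [_ [r Dr <-]]; exists r.
- by move=> j [].
have [|x0 hx0] := dirG (D := [set x | D (inj_at x)]).
  by apply: small_le sD; apply: (card_leI (f := @inj_at d)) => // x y _ _ /inj_at_inj.
exists j0 => //; exists x0.
have side r : D r -> (forall s, near j0 x0 s -> lt s r) \/
                     (forall s, near j0 x0 s -> lt r s).
  case: r => k z Dr; case: (lt_total k d) => [h|e|h].
  - right=> s; have kj0 : lt k j0 by apply: hj0; split=> //; exists (existT _ k z).
    case=> [[j0s _]|[x -> _]]; apply: lt_tag => //; exact: lt_trans j0s.
  - subst k; left=> s [[_ sd]|[x -> x0x]]; first exact: lt_tag.
    by apply/lt_inj_at; apply: lt_trans x0x; apply: hx0.
  - left=> s [[_ sd]|[x -> _]]; apply: lt_tag => //; exact: lt_trans h.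
move=> s t ns nt r /side[] h; have hs := h s ns; have ht := h t nt; split.
- by [].
- by split=> e; [move: hs; rewrite e => /lt_irr|move: ht; rewrite e => /lt_irr].
- by split=> e; [have := lt_trans e hs|have := lt_trans e ht] => /lt_irr.
- by split=> e; [move: hs; rewrite e => /lt_irr|move: ht; rewrite e => /lt_irr].
Qed.

(** [Q] is constant near the cut, so its truth passes from cofinally many points on the left to all
    points close by on the right. *)
Lemma cut_transfer (Q : sumrev -> Prop) (D : set sumrev) : small D ->
  (forall s t, same_cut D s t -> (Q s <-> Q t)) ->
  (forall j, lt j d -> exists s, [/\ lt j (tag s), lt (tag s) d & Q s]) ->
  exists x0, forall x : G d, lt x0 x -> Q (inj_at x).
Proof.
move=> /cut_stable[j0 j0d [x0 st]] QD cof; exists x0 => x x0x.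
have [s [j0s sd Qs]] := cof _ j0d.
apply/(QD s) => //; apply: st; [by left|by right; exists x].
Qed.

End Cut.
End SumRev.

Section Interleaving.
Variables (J : linorder) (G G' : J -> linorder).
Hypothesis dirG : forall i, kdir (G i).
Variables (T : Type) (P : T -> T -> Prop).
Variables (a : sumrev G -> T) (b : sumrev G' -> T).

(* If [d] is closed under the thresholds of interleaving, then cofinally many
   [s] below [d] satisfy [P (a s) (b t)] for all [t] in the [d]-th summand;
   [cut_transfer] moves this across the cut. *)
Lemma half_interleaved_block : skeleton P a -> half_interleaved P a b ->
  exists tau : J -> J, forall d, kdir_below d -> closed_at tau d ->
    half_interleaved (dual P) (fun x : G' d => b (inj_at x)) (fun x : G d => a (inj_at x)).
Proof.
move=> ska hab.
have /choice[tau tauP] : forall j, exists i, exists s, [/\ le j (tag s), le (tag s) i &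
    forall t, lt i (tag t) -> P (a s) (b t)].
  move=> j; have [g _] := kdir_inhab (@dirG j).
  have [s js [t0 ht0]] := hab (inj_at g).
  have [i [si ti]] := le_max (tag s) (tag t0).
  exists i, s; split=> //; first exact: (le_tag js).
  by move=> t it; apply: ht0; apply: lt_tag; apply: le_lt_trans ti it.
exists tau => d dird cd t0; exists t0; first exact: le_refl.
have [D sD QD] := skeleton_l ska (b (inj_at t0)).
apply: (cut_transfer dird (@dirG d) sD QD) => j jd.
have [||j1 j1d jj1] := dird [set j]; first exact: small_finite.
  by move=> _ ->.
have [j' j1j' [j'd td]] := cd _ j1d.
have [s [j's st Ps]] := tauP j'; exists s; split.
- by apply: lt_le_trans (jj1 _ erefl) _; apply: le_trans j's.
- exact: le_lt_trans td.
- exact: Ps.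
Qed.

End Interleaving.

Lemma interleaved_block (J : linorder) (G G' : J -> linorder) T (P : T -> T -> Prop)
    (a : sumrev G -> T) (b : sumrev G' -> T) :
  (forall i, kdir (G i)) -> (forall i, kdir (G' i)) ->
  skeleton P a -> skeleton P b -> interleaved P a b ->
  exists tau : J -> J, forall d, kdir_below d -> closed_at tau d ->
    interleaved (dual P) (fun x : G d => a (inj_at x)) (fun x : G' d => b (inj_at x)).
Proof.
move=> dG dG' sa sb [/(half_interleaved_block dG sa)[t1 h1] /(half_interleaved_block dG' sb)[t2 h2]].
have /choice[tau tauP] := fun j => le_max (t1 j) (t2 j).
exists tau => d dd cd; split.
- by apply: h2 => //; apply: closed_at_le cd => j; have [] := tauP j.
- by apply: h1 => //; apply: closed_at_le cd => j; have [] := tauP j.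
Qed.

Lemma separated_sumrev (J : linorder) (G G' : J -> linorder) (A : set J) :
  (forall i, kdir (G i)) -> (forall i, kdir (G' i)) -> stationary A ->
  (forall i, A i -> separated (G i) (G' i)) -> separated (sumrev G) (sumrev G').
Proof.
move=> dG dG' sA sG T P a b aP sa sb /(interleaved_block dG dG' sa sb)[tau h].
have [d Ad [dd cd]] := sA tau.
exact: (sG d Ad _ _ _ _ (asym_dual aP) (skeleton_block d sa) (skeleton_block d sb) (h d dd cd)).
Qed.

Lemma stat_gt (J : linorder) (y : J) : wellorder J -> kbound J -> stationary [set x | lt y x].
Proof.
move=> wfJ bJ tau.
have /choice[tau' tauP] := fun j => le_max y (tau j).
have [x _ [dx cx]] := stat_setT wfJ bJ tau'.
exists x; first by apply: (closed_at_gt dx cx) => j; have [] := tauP j.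
by split=> //; apply: closed_at_le cx => j; have [] := tauP j.
Qed.

(** The [kappa] many thresholds of the [s k] have a common bound in [J]. Some [b t] beyond it
    satisfies [P (a (s k)) (b t)] for all [k], but also [P (b t) (a (s k))] once [k] is large,
    against asymmetry. *)
Lemma separated_kbound (J : linorder) : kbound J -> separated K J.
Proof.
move=> bJ T P a b aP sa sb [hab hba].
have /choice[s sP] : forall k, exists s, le k s /\
    exists t0, forall t, lt t0 t -> P (a s) (b t).
  by move=> k; have [s ks h] := hab k; exists s.
have /choice[t0 t0P] : forall k, exists t0, forall t, lt t0 t -> P (a (s k)) (b t).
  by move=> k; have [] := sP k.
have [t1 t1P] := bJ _ (card_range_le t0).
have [t t1t [k0 hk0]] := hba t1.
have [k k0k] := kdir_nomax k0 dirK.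
apply: (aP (a (s k)) (b t)).
- by apply: t0P; apply: lt_le_trans t1t; apply: t1P; exists k.
- by apply: hk0; apply: lt_le_trans k0k _; have [] := sP k.
Qed.

(** * Orders coding the subsets of lambda *)

Section Lambda.
Variable L : linorder.
Hypothesis wfL : wellorder L.
Hypothesis initialL : forall x : L, ~ ([set: L] #<= seg x).
Hypothesis KL : [set: K] #<= [set: L].
Hypothesis nLK : ~ ([set: L] #<= [set: K]).

Lemma infL : infinite_set [set: L].
Proof. by move=> fL; apply: infK; apply: card_le_finite fL. Qed.

Definition succK : linorder := succ_order L [set: K].

Lemma wf_succK : wellorder succK. Proof. exact: wf_succ. Qed.

Lemma kbound_succK : kbound succK.
Proof. by move=> D; apply: succ_bound. Qed.

Lemma card_sub_order (A : set L) : [set: sub_order A] #<= [set: L].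
Proof. by apply: (card_leI (f := sval)) => // x y _ _; apply: sval_injective. Qed.

(** [kdir] and the size bound let [O Z] serve as a summand later. The opposite difference, [y] in
    [Z'] only, is covered by exchanging [Z] and [Z']. *)
Definition codes (B : set L) (O : set L -> linorder) :=
  (forall Z, kdir (O Z) /\ [set: O Z] #<= [set: L]) /\
  forall Z Z' y, B y -> Z y -> ~ Z' y -> separated (O Z) (O Z').

Definition codable (B : set L) := exists O, codes B O.

(** A single bit is coded by the cofinality: [kappa] if [y] is in [Z], and [kappa^+] otherwise. *)
Lemma codable1 (y : L) : codable [set y].
Proof.
exists (fun Z => if pselect (Z y) then K else succK); split=> [Z|Z Z' _ -> Zy Z'y].
  by case: pselect => Zy; split=> //; [exact: (kbound_kdir kbound_succK)|exact: card_sub_order].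
case: pselect => // Zy'; case: pselect => // nZ'y.
exact: (separated_kbound kbound_succK).
Qed.

Lemma codable_sub (A B : set L) : A `<=` B -> codable B -> codable A.
Proof.
by move=> AB [O [OP h]]; exists O; split=> // Z Z' y /AB; apply: h.
Qed.

Lemma codable_sumrev (J : linorder) (O : J -> set L -> linorder) (C : J -> set L) (B : set L) :
  kdir J -> [set: J] #<= [set: L] -> (forall i, codes (C i) (O i)) ->
  (forall y, B y -> stationary [set i | C i y]) -> codable B.
Proof.
move=> dJ JL OP BC; exists (fun Z => sumrev (fun i => O i Z)).
have dO i Z : kdir (O i Z) by have [/(_ Z)[]] := OP i.
split=> [Z|Z Z' y By Zy Z'y].
  split; first by apply: kdir_sumrev => // i; apply: kdir_inhab.
  by apply: card_sumrev => //; [exact: infL|move=> i; have [/(_ Z)[]] := OP i].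
apply: separated_sumrev (BC y By) _ => // i Ci.
by have [_ h] := OP i; apply: h Ci Zy Z'y.
Qed.

(** In a sum along [kappa^+], an Ulam partition gives each [B xi] a stationary set of summands
    coding it. *)
Lemma codable_bigcup (B : K -> set L) : (forall xi, codable (B xi)) ->
  codable [set y | exists xi, B xi y].
Proof.
move=> /choice[O OP].
have [p pP] := stat_partition wf_succK kbound_succK (@succ_seg L K [set: K]).
apply: (codable_sumrev (J := succK) (O := fun i => O (p i)) (C := fun i => B (p i))) => //.
- exact: (kbound_kdir kbound_succK).
- exact: card_sub_order.
- move=> y [xi By]; apply: stat_mono (pP xi) => i /= -> //.
Qed.

Lemma codable_setU (A B : set L) : codable A -> codable B -> codable (A `|` B).
Proof.
move=> cA cB; have [k0 _] := kdir_inhab dirK; have [k1 k01] := kdir_nomax k0 dirK.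
apply: (codable_sub (B := [set y | exists xi : K,
    (if pselect (xi = k0) then A else B) y])).
  move=> y [Ay|By]; [exists k0|exists k1]; case: pselect => //.
  by move=> e; exfalso; move: k01; rewrite e => /lt_irr.
by apply: codable_bigcup => xi; case: pselect.
Qed.

(* If [B] has cofinality [> kappa], sum over [B] itself: from the first
   difference of [Z] and [Z'] on, all summands are separated. Otherwise [B] is a
   union of at most [kappa] closed segments. *)
Lemma codable_down (B : set L) : (forall y, B y -> codable (seg y)) -> codable B.
Proof.
move=> cseg; case: (pselect (kbound (sub_order B))) => [bB|nbB].
  have /choice[O OP] : forall i : sub_order B, codable (seg (sval i)).
    by move=> i; apply: cseg; apply: (proj2_sig i).
  apply: (codable_sumrev (J := sub_order B) (O := O) (C := fun i => seg (sval i))) => //.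
  - exact: kbound_kdir.
  - exact: card_sub_order.
  - move=> y By; apply: (stat_gt (J := sub_order B) (exist _ y By)) => //.
    exact: wf_preim.
have [D DK Dunb] : exists2 D : set (sub_order B), D #<= [set: K] &
    ~ exists u, forall d, D d -> lt d u.
  by apply: contrapT => n; apply: nbB => D DK; apply: contrapT => h; apply: n; exists D.
have [k0 _] := kdir_inhab dirK.
have [|i [_ iinj]] := card_leE DK _; first by exists k0.
apply: (codable_sub (B := [set y | exists xi : K,
    [set y | exists d, [/\ D d, i d = xi & le y (sval d)]] y])).
  move=> y By; pose y' : sub_order B := exist _ y By.
  have [d Dd yd] : exists2 d, D d & le y' d.
    apply: contrapT => n; apply: Dunb; exists y' => d Dd.
    by apply: nleP => h; apply: n; exists d.
  by exists (i d), d.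
apply: codable_bigcup => xi; case: (pselect (exists2 d, D d & i d = xi)).
  move=> [d Dd dxi]; apply: (codable_sub (B := [set sval d] `|` seg (sval d))).
    move=> y [d' [Dd' d'xi yd']]; have <- : d' = d by apply: iinj => //; rewrite dxi.
    case: (lt_total y (sval d')) => [h|->|/yd'//]; [by right|by left].
  by apply: codable_setU; [apply: codable1|apply: cseg; apply: (proj2_sig d)].
(* Here [xi] is the index of no [d], and the set is empty; [[set l]] is any codable superset. *)
have [l _] := infinite_setN0 infL.
move=> n; apply: (codable_sub _ (codable1 l)) => y [d [Dd dxi _]].
by case: n; exists d.
Qed.

Lemma codable_setT : codable [set: L].
Proof.
apply: codable_down => y _; move: y.
by apply: (well_founded_ind (wf_well_founded wfL)) => x IH; apply: codable_down.
Qed.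

Lemma nomaxL (x : L) : exists y, lt x y.
Proof.
apply: contrapT => nx; apply: (@initialL x).
have xT : [set: L] `<=` x |` seg x.
  by move=> y _; case: (lt_total y x) => [h|->|h]; [right|left|case: nx; exists y].
apply: (card_le_trans (subset_card_le xT)); apply: infinite_setU1 => fx.
by apply: infL; apply: (sub_finite_set xT); rewrite finite_setU.
Qed.

(** * Naming the cuts *)

(* Applied to [g j] the rank in [lambda] of a point of the [j]-th summand, this
   provides a cut [d] whose left side is cofinally made of points of rank
   [< p d], whereas its right side [side (p d) X] has cofinality
   [> |seg (p d)|]. *)
Definition guesses (J : linorder) (p : J -> L) :=
  forall g : J -> L, exists2 d, kdir_below d & forall j, lt j d ->
    exists2 j', le j j' & lt j' d /\ lt (g j') (p d).

(** If [L] has cofinality above [kappa], its closed points guess with [p] the identity. Otherwise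
    let [c] list a cofinal subset along [K] and replace each rank by an upper bound [c xi]: one [xi]
    serves for unboundedly many [j] of [kappa^+], and an Ulam partition supplies stationarily many
    [d] with value [c xi]. *)
Lemma exists_guesses : exists (J : linorder) (p : J -> L),
  [/\ kdir J, [set: J] #<= [set: L] & guesses p].
Proof.
case: (pselect (kbound L)) => [bL|nbL].
  exists L, id; split; [exact: kbound_kdir|by []|move=> g].
  by have [d _ [dd cd]] := stat_setT wfL bL g; exists d.
have [D DK Dunb] : exists2 D : set L, D #<= [set: K] &
    ~ exists u, forall d, D d -> lt d u.
  by apply: contrapT => n; apply: nbL => D DK; apply: contrapT => h; apply: n; exists D.
have [k0 _] := kdir_inhab dirK.
have [|i [_ iinj]] := card_leE DK _; first by exists k0.
have [l0 _] := infinite_setN0 infL.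
have /choice[c cP] : forall xi : K, exists l, forall d, D d -> i d = xi -> l = d.
  move=> xi; case: (pselect (exists2 d, D d & i d = xi)) => [[d Dd dxi]|n].
    by exists d => d' Dd' d'xi; apply: iinj => //; rewrite dxi.
  by exists l0 => d Dd dxi; case: n; exists d.
have cofc l : exists xi, lt l (c xi).
  have [l' ll'] := nomaxL l.
  apply: contrapT => n; apply: Dunb; exists l' => d Dd; apply: nleP => l'd.
  apply: n; exists (i d); rewrite (cP _ d Dd erefl).
  exact: lt_le_trans ll' l'd.
have [p pP] := stat_partition wf_succK kbound_succK (@succ_seg L K [set: K]).
exists succK, (c \o p); split; [exact: (kbound_kdir kbound_succK)|exact: card_sub_order|].
move=> g; have /choice[q qP] := fun j => cofc (g j).
have [xi unb] := unbounded_fiber q kbound_succK.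
have /choice[tau tauP] : forall j, exists a, q a = xi /\ lt j a.
  by move=> j; have [a] := unb j; exists a.
have [d pd [dd cd]] := pP xi tau; exists d => // j jd.
have [j' jj' [j'd td]] := cd j jd; have [qt j't] := tauP j'.
exists (tau j'); first by apply: ltW; apply: le_lt_trans j't.
by split=> //=; move: pd => /= ->; rewrite -qt; apply: qP.
Qed.

(** [N] is the larger of [seg x] and a copy of [K] in [L]; both are smaller than [lambda]. *)
Lemma exists_bound (x : L) : exists N : set L,
  [/\ infinite_set N, ~ ([set: L] #<= N), seg x #<= N & [set: K] #<= N].
Proof.
case: (card_le_total K (seg x)) => [Kx|xK].
  exists (seg x); split=> //.
  by move=> fx; apply: infK; apply: card_le_finite fx.
have [l0 _] := infinite_setN0 infL.
have [|e [_ einj]] := card_leE KL _; first by exists l0.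
have KN : [set: K] #<= range e.
  by apply: (card_leI (f := e)) => [k _|]; [exists k|].
exists (range e); split=> //.
- by move=> fN; apply: infK; apply: card_le_finite fN.
- by move=> LN; apply: nLK; apply: (card_le_trans LN); apply: card_image_le.
- exact: card_le_trans KN.
Qed.

Section Top.
Variables (O : set L -> linorder) (J : linorder) (p : J -> L) (N : L -> set L).
Hypothesis OP : codes [set: L] O.
Hypothesis dirJ : kdir J.
Hypothesis JL : [set: J] #<= [set: L].
Hypothesis guessp : guesses p.
Hypothesis NP : forall x, [/\ infinite_set (N x), ~ ([set: L] #<= N x),
  seg x #<= N x & [set: K] #<= N x].

(** The constant summand keeps the coding of [X], and the index order raises the cofinality above
    [N x]. *)
Definition side (x : L) (X : set L) : linorder :=
  sumrev (fun _ : succ_order L (N x) => O X).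

Lemma O_inhab X : [set: O X] !=set0.
Proof. by apply: kdir_inhab; have [/(_ X)[]] := OP. Qed.

Lemma side_bound x X (D : set (side x X)) : D #<= N x ->
  exists u, forall d, D d -> lt d u.
Proof.
move=> DN; have [infN nLN _ _] := NP x.
apply: sumrev_bound => [_|]; first exact: O_inhab.
apply: succ_bound => //; apply: card_le_trans DN; exact: card_image_le.
Qed.

Lemma kdir_side x X : kdir (side x X).
Proof.
apply: kbound_kdir => D DK; apply: side_bound.
by have [_ _ _ KN] := NP x; apply: card_le_trans KN.
Qed.

Lemma card_side x X : [set: side x X] #<= [set: L].
Proof.
apply: card_sumrev; [exact: infL|exact: card_sub_order|move=> _].
by have [/(_ X)[]] := OP.
Qed.

Lemma separated_side x X Y : X <> Y -> separated (side x X) (side x Y).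
Proof.
move=> XY; have [infN nLN _ KN] := NP x.
have kN : kbound (succ_order L (N x)).
  by move=> D DK; apply: succ_bound => //; apply: card_le_trans KN.
have dO Z : kdir (O Z) by have [/(_ Z)[]] := OP.
apply: (separated_sumrev (A := setT)) => //.
  by apply: stat_setT => //; apply: wf_succ.
move=> _ _; have [_ h] := OP.
have [y Xy] : exists y, ~ (X y <-> Y y).
  apply: contrapT => n; apply: XY; apply/seteqP.
  by split=> y; apply: contrapT => nxy; apply: n; exists y; tauto.
case: (pselect (X y)) => hX; case: (pselect (Y y)) => hY; do ?tauto.
  exact: (h X Y y).
by apply: separated_sym; apply: (h Y X y).
Qed.

Definition coding_order (X : set L) : linorder := sumrev (fun d : J => side (p d) X).

Lemma card_coding_order X : [set: coding_order X] #<= [set: L].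
Proof. by apply: card_sumrev => // [|d]; [exact: infL|exact: card_side]. Qed.

Section Name.
Variables (T : Type) (P : T -> T -> Prop) (idx : T -> L).
Hypothesis idx_inj : injective idx.

(* The value [a (inj_at u)] determines [P c (a x)] for all [c] of rank [< p d] and
   all [x] close to the cut; together with [p d] it is the name of the cut. *)
Definition names X (a : coding_order X -> T) (d : J) (u : side (p d) X) :=
  [/\ kdir_below d,
      forall j, lt j d -> exists s, [/\ le j (tag s), lt (tag s) d & lt (idx (a s)) (p d)]
    & forall c, lt (idx c) (p d) -> forall x, lt u x ->
        (P c (a (inj_at x)) <-> P c (a (inj_at u)))].

Lemma exists_names X (a : coding_order X -> T) : skeleton P a ->
  exists d (u : side (p d) X), names a u.
Proof.
move=> ska.
have /choice[r rP] : forall j : J, exists s : coding_order X, tag s = j.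
  move=> j; have [x _] := kdir_inhab (@kdir_side (p j) X).
  by exists (inj_at (G := fun d => side (p d) X) x).
have [d dd cd] := guessp (idx \o a \o r).
have dirs := @kdir_side (p d) X.
(* Beyond [beta c], the truth of [P c] no longer changes along the right side of the cut. *)
have /choice[beta betaP] : forall c, exists u : side (p d) X, forall x y,
    lt u x -> lt u y -> (P c (a (inj_at x)) <-> P c (a (inj_at y))).
  move=> c; have [D sD QD] := skeleton_r ska c.
  have [j0 _ [x0 st]] := cut_stable dd dirs sD.
  by exists x0 => x y x0x x0y; apply: QD; apply: st; right; [exists x|exists y].
(* Since [idx] is injective, at most [seg (p d)] many [c] have rank below [p d], so one [u] exceeds
   all their [beta c]. *)
have [|u uP] := side_bound (D := beta @` [set c | lt (idx c) (p d)]).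
  apply: card_le_trans (card_image_le _ _) _; have [_ _ sN _] := NP (p d).
  by apply: card_le_trans sN; apply: (card_leI (f := idx)) => // x y _ _ /idx_inj.
exists d, u; split=> //.
  move=> j jd; have [j' jj' [j'd gj']] := cd j jd.
  by exists (r j'); rewrite rP; split.
move=> c cd' x ux; have bu : lt (beta c) u by apply: uP; exists c.
by apply: betaP => //; apply: lt_trans ux.
Qed.

(** A point [a s] left of the cut satisfies [P (a s) (a (inj_at u))]. If its rank is below [p d],
    the common value at [u] and [u'] turns this into [P (a s) (b (inj_at t))] for [t] beyond [u'],
    and [cut_transfer] carries it to the right side of the cut of [a]. *)
Lemma names_half_interleaved X Y (a : coding_order X -> T) (b : coding_order Y -> T) d d'
    (u : side (p d) X) (u' : side (p d') Y) :
  skeleton P a -> names a u -> names b u' -> p d = p d' ->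
  a (inj_at u) = b (inj_at u') ->
  half_interleaved (dual P) (fun y : side (p d') Y => b (inj_at y))
                (fun x : side (p d) X => a (inj_at x)).
Proof.
move=> ska [dd ca _] [_ _ cb] pdd' uu' t0.
have [t t0t u't] := le_exists_gt t0 u' (@kdir_side (p d') Y).
exists t; first exact: ltW.
have [D sD QD] := skeleton_l ska (b (inj_at t)).
apply: (cut_transfer dd (@kdir_side (p d) X) sD QD) => j jd.
have [||j1 j1d jj1] := dd [set j]; first exact: small_finite.
  by move=> _ ->.
have [s [js sd sp]] := ca _ j1d; exists s; split=> //.
  exact: lt_le_trans (jj1 _ erefl) js.
have /(cb (a s))/(_ _ u't) h : lt (idx (a s)) (p d') by rewrite -pdd'.
by apply/h; rewrite -uu'; apply/(skeleton_lt ska); apply: lt_tag.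
Qed.

Lemma names_inj X Y (a : coding_order X -> T) (b : coding_order Y -> T) d d'
    (u : side (p d) X) (u' : side (p d') Y) : asym P ->
  skeleton P a -> skeleton P b -> names a u -> names b u' -> p d = p d' ->
  a (inj_at u) = b (inj_at u') -> X = Y.
Proof.
move=> aP sa sb na nb pdd' uu'; apply: contrapT => XY.
have sep : separated (side (p d) X) (side (p d') Y).
  by rewrite pdd'; apply: separated_side.
apply: (sep _ _ _ _ (asym_dual aP) (skeleton_block d sa) (skeleton_block d' sb)).
by split; [apply: (names_half_interleaved sb nb na)|apply: (names_half_interleaved sa na nb)].
Qed.

End Name.
End Top.

Lemma is_linorder_bool : is_linorder (fun x y : bool => ~~ x && y).
Proof.
split; [by case|by do 3 case|].
by do 2 case; [constructor 2|constructor 3|constructor 1|constructor 2].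
Qed.
Definition bool_order : linorder := Linorder is_linorder_bool.

Lemma exists_named_orders : exists I : set L -> linorder,
  (forall X, [set: I X] #= [set: L]) /\
  forall (T : Type) (P : T -> T -> Prop), asym P -> [set: T] #<= [set: L] ->
    exists nm : set L -> L, forall X Y,
      (exists a : I X -> T, skeleton P a) -> (exists b : I Y -> T, skeleton P b) ->
      nm X = nm Y -> X = Y.
Proof.
have [O OP] := codable_setT.
have [J [p [dJ JL gp]]] := exists_guesses.
have /choice[N NP] := exists_bound.
(* The summand [L] pads the order to cardinality exactly [lambda]. *)
pose G X (b : bool_order) := if b then coding_order O p N X else L.
have [l0 _] := infinite_setN0 infL.
exists (fun X => sumrev (G X)); split=> [X|T P aP TL].
  apply/card_eqPle; split.
    apply: card_sumrev; first exact: infL.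
      by apply: (finite_le_infinite infL); apply: finite_finset.
    by case; [apply: card_coding_order|].
  apply: (card_leI (f := fun x : L => inj_at (G := G X) (i := false) x)) => //.
  by move=> x y _ _ /inj_at_inj.
have [|idx [_ idx_inj]] := card_leE TL _; first by exists l0.
have [|pair [_ pair_inj]] := card_leE (card_square infL) _; first by exists l0.
have idx_inj' : injective idx by move=> x y; apply: idx_inj.
have /choice[nm nmP] : forall X, exists l, (exists a : sumrev (G X) -> T, skeleton P a) ->
    exists (a : coding_order O p N X -> T) d (u : side O N (p d) X),
      [/\ skeleton (dual P) a, names (dual P) idx a u &
          l = pair (p d, idx (a (inj_at u)))].
  move=> X; case: (pselect (exists a : sumrev (G X) -> T, skeleton P a)); last first.
    by move=> n; exists l0 => /n.
  move=> [a /(skeleton_block (true : bool_order)) sa].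
  have [d [u nu]] := exists_names OP gp NP idx_inj' sa.
  by eexists => _; eexists; exists d, u; split; [exact: sa|exact: nu|].
exists nm => X Y /nmP[a [d [u [sa na ->]]]] /nmP[b [d' [u' [sb nb ->]]]].
move=> /pair_inj -/(_ I I)[pdd' /idx_inj'].
exact: (names_inj OP NP (asym_dual aP) sa sb na nb pdd').
Qed.

End Lambda.
End Kappa.

(** * From models to skeletons *)

Section OrderType.
Variable I : linorder.

(** An alias of the carrier of [I], to hold the [orderType] structure that the hypothesis of the
    theorem asks for. *)
Definition order_sort : Type := I.
HB.instance Definition _ := gen_eqMixin order_sort.
HB.instance Definition _ := gen_choiceMixin order_sort.

Let ltb (x y : order_sort) := `[< @lt I x y >].

Let ltb_irr : irreflexive ltb.
Proof. by move=> x; apply/asboolP/lt_irr. Qed.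

Let ltb_trans : transitive ltb.
Proof.
by move=> y x z /asboolP xy /asboolP yz; apply/asboolP; apply: lt_trans xy yz.
Qed.

HB.instance Definition _ := Order.Lt_isPOrder.Build (Order.Disp tt tt) order_sort
  ltb_irr ltb_trans.

Let le_total : total (<=%O : rel order_sort).
Proof.
move=> x y; rewrite !Order.POrderTheory.le_eqVlt.
case: (@lt_total I x y) => [h| ->|h].
- by rewrite [(x < y)%O](introT (asboolP _) h) orbT.
- by rewrite eqxx.
- by rewrite [(y < x)%O](introT (asboolP _) h) !orbT.
Qed.

HB.instance Definition _ := Order.POrder_isTotal.Build (Order.Disp tt tt) order_sort
  le_total.

Lemma lt_order_sort (x y : order_sort) : (x < y)%O <-> @lt I x y.
Proof. exact: (iff_sym (rwP (asboolP (@lt I x y)))). Qed.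

End OrderType.

Section Transfer.
Variables (K : linorder) (L : logic) (tau : vocabulary) (n : nat).
Variable phi : formula_in L tau ('I_n + 'I_n).

Definition phi_rel (M : model tau) (a b : 'I_n -> M) := holds phi (join_assign a b).

Lemma isomorphism_inv (M N : model tau) (h : M -> N) : is_isomorphism h ->
  exists g : N -> M, is_isomorphism g.
Proof.
move=> [[g hg gh] hr hf]; exists g; split; first by exists h.
- move=> r x; rewrite (hr r (g \o x)).
  by have -> : h \o (g \o x) = x by apply/funext => i /=; rewrite gh.
- move=> f x; apply: (can_inj hg); rewrite gh hf.
  by congr finterp; apply/funext => i /=; rewrite gh.
Qed.

Lemma isomorphic_sym (M N : model tau) : isomorphic M N -> isomorphic N M.
Proof. by move=> [h /isomorphism_inv]. Qed.

Lemma isomorphic_trans (M N Q : model tau) :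
  isomorphic M N -> isomorphic N Q -> isomorphic M Q.
Proof.
move=> [h [hb hr hf]] [g [gb gr gf]]; exists (g \o h); split.
- exact: bij_comp.
- by move=> r x; rewrite hr gr.
- by move=> f x /=; rewrite hf gf.
Qed.

Lemma phi_rel_isomorphism (M N : model tau) (h : M -> N) (a b : 'I_n -> M) :
  is_isomorphism h -> (phi_rel a b <-> phi_rel (h \o a) (h \o b)).
Proof.
move=> [hb hr hf]; have h' : @is_isomorphism (subvocabulary (rvoc phi) (fvoc phi))
    (reduct _ _ M) (reduct _ _ N) h.
  by split=> // [r x|f x]; [apply: hr|apply: hf].
rewrite /phi_rel /holds (sat_isomorphism (form phi) _ h').
by have -> : h \o join_assign a b = join_assign (h \o a) (h \o b)
  by apply/funext => -[].
Qed.

Lemma weakly_skeleton_like_skeleton (I : linorder) (M : model tau)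
    (a : order_sort I -> 'I_n -> M) :
  weakly_skeleton_like K phi a -> skeleton K (@phi_rel M) (a : I -> 'I_n -> M).
Proof.
move=> [_ sk ska]; split=> [s t|c|c].
- by rewrite -lt_order_sort; apply: ska.
- have [|D [sD h]] := sk (phi_instance phi c); first by exists c; left.
  exists D => // s t st; have := h s t; rewrite /pholds /=.
  have E (u : 'I_n -> M) : join_assign u id \o join_assign inl (inr \o c) =
      join_assign u c by apply/funext => -[].
  rewrite !E; apply => r Dr; rewrite !lt_order_sort; exact: st.
- have [|D [sD h]] := sk (psi_instance phi c); first by exists c; right.
  exists D => // s t st; have := h s t; rewrite /pholds /=.
  have E (u : 'I_n -> M) : join_assign u id \o join_assign (inr \o c) inl =
      join_assign c u by apply/funext => -[].
  rewrite !E; apply => r Dr; rewrite !lt_order_sort; exact: st.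
Qed.

Lemma skeleton_isomorphic (I : linorder) (M N : model tau) : isomorphic M N ->
  (exists a : I -> 'I_n -> M, skeleton K (@phi_rel M) a) ->
  exists b : I -> 'I_n -> N, skeleton K (@phi_rel N) b.
Proof.
move=> [h hiso] [a [alt al ar]]; exists (fun s => h \o a s).
have [[g hg gh] _ _] := hiso.
have hgE (c : 'I_n -> N) : c = h \o (g \o c) by apply/funext => i /=; rewrite gh.
split=> [s t|c|c].
- by rewrite -(phi_rel_isomorphism _ _ hiso).
- have [D sD hD] := al (g \o c); exists D => // s t st; rewrite (hgE c).
  by split=> /(phi_rel_isomorphism _ _ hiso) h1;
     apply/(phi_rel_isomorphism _ _ hiso); apply/(hD s t st).
- have [D sD hD] := ar (g \o c); exists D => // s t st; rewrite (hgE c).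
  by split=> /(phi_rel_isomorphism _ _ hiso) h1;
     apply/(phi_rel_isomorphism _ _ hiso); apply/(hD s t st).
Qed.

End Transfer.

(** * Counting isomorphism classes *)

Lemma card_tuples (M U : Type) (n : nat) : infinite_set [set: U] ->
  [set: M] #<= [set: U] -> [set: 'I_n -> M] #<= [set: U].
Proof.
move=> infU MU; have [u0 _] := infinite_setN0 infU.
have [|m [_ minj]] := card_leE MU _; first by exists u0.
have [|pair [_ pinj]] := card_leE (card_square infU) _; first by exists u0.
elim: n => [|n IH].
  apply: (card_leI (f := fun=> u0)) => // x y _ _ _.
  by apply/funext => -[].
have [|f [_ finj]] := card_leE IH _; first by exists u0.
apply: (card_leI (f := fun x => pair (m (x ord0), f (fun i => x (lift ord0 i))))) => //.
move=> x y _ _ /pinj-/(_ I I)[/minj-/(_ I I) xy0 /finj-/(_ I I) xy].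
apply/funext => i; case: (unliftP ord0 i) => [j|] ->; last exact: xy0.
exact: (f_equal (fun z => z j) xy).
Qed.

(* The diagonal argument: cut [U] into [U] many copies [pair l @` U] of itself. If
   no name [l] were good, then for each [l] some [Z l] would not be the [l]-th
   part of any set named [l], and the set with parts [Z l] would have no name. *)
Lemma exists_full_name (U : Type) (nm : set U -> U) : infinite_set [set: U] ->
  exists l (X : set U -> set U), injective X /\ forall Z, nm (X Z) = l.
Proof.
move=> infU; have [u0 _] := infinite_setN0 infU.
have [|pair [_ pinj]] := card_leE (card_square infU) _; first by exists u0.
pose part l (X : set U) : set U := [set u | X (pair (l, u))].
have [l lP] : exists l, forall Z, exists X, nm X = l /\ part l X = Z.
  apply: contrapT => n.
  have /choice[Z ZP] : forall l, exists Z, forall X, nm X = l -> part l X <> Z.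
    move=> l; apply: contrapT => nZ; apply: n; exists l => Z.
    apply: contrapT => nX; apply: nZ; exists Z => X h1 h2; apply: nX; by exists X.
  pose X := [set x | exists l u, x = pair (l, u) /\ Z l u].
  apply: (ZP (nm X) X erefl); apply/seteqP; split=> u.
    by move=> [l [v [/pinj-/(_ I I)[-> ->]]]].
  by move=> Zu; exists (nm X), u.
have /choice[X XP] := lP; exists l, X; split=> [Z Z' e|Z]; last by have [] := XP Z.
by have [_ <-] := XP Z; have [_ <-] := XP Z'; rewrite e.
Qed.

Theorem theorem3p9
    (kappa lambda : Type)
    (kappa_lt_lambda : card_lt [set: kappa] [set: lambda])
    (kappa_regular : regular_cardinal kappa)
    (tau : vocabulary)
    (K_lambda : model tau -> Prop)
    (K_lambda_card : forall M : model tau, K_lambda M -> [set: M] #= [set: lambda])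
    (L : logic) (n : nat) (phi : formula_in L tau ('I_n + 'I_n))
    (phi_asymmetric : forall M : model tau, K_lambda M -> asymmetric (G := 'I_n) phi M)
    (skeletons : forall (d : Order.disp_t) (J : orderType d),
       [set: J] #= [set: lambda] ->
       exists (M : model tau) (a : J -> 'I_n -> M),
         K_lambda M /\ weakly_skeleton_like (G := 'I_n) kappa phi a) :
  exists F : set lambda -> model tau,
    (forall X, K_lambda (F X)) /\
    (forall X Y, X <> Y -> ~ isomorphic (F X) (F Y)).
Proof.
have [infk [R [[woR _] Rcof]]] := kappa_regular.
have [h wfK] := well_order_linorder woR; pose K := Linorder h.
(* A set without strict upper bound is cofinal for [R], hence of full size by regularity. *)
have dirK : kdir K K.
  move=> D [DK nDK]; apply: contrapT => nu.
  have DE : D #= [set: kappa].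
    apply: Rcof => x; apply: contrapT => nx; apply: nu; exists x => y Dy /=.
    by apply/negP => Rxy; apply: nx; exists y.
  by rewrite DE in nDK.
have [r [hr [wfL initL]]] := exists_initial_wo lambda; pose Lam := Linorder hr.
have [KL /negP KnL] := kappa_lt_lambda.
have nLK : ~ ([set: Lam] #<= [set: K]).
  by move=> LK; apply: KnL; apply/card_eqPle.
have infL : infinite_set [set: lambda] by move=> fL; apply: infk; apply: card_le_finite fL.
have [I [cI nmI]] := exists_named_orders (K := K) (L := Lam) wfK infk dirK wfL initL KL nLK.
have /choice[M0 M0P] : forall X : set lambda, exists M : model tau, K_lambda M /\
    exists a : I X -> 'I_n -> M, skeleton K (@phi_rel L tau n phi M) a.
  move=> X; have [M [a [KM ska]]] := skeletons _ (order_sort (I X)) (cI X).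
  by exists M; split=> //; exists a; apply: weakly_skeleton_like_skeleton.
have KM X : K_lambda (M0 X) by have [] := M0P X.
(* [rep] depends only on the set of indices, so isomorphic models get the same representative
   [cls]. *)
have /choice[rep repP] : forall c : set lambda -> Prop, exists X, (exists Y, c Y) -> c X.
  move=> c; case: (pselect (exists Y, c Y)) => [[Y cY]|nc]; first by exists Y.
  by exists set0.
pose cls X := rep [set Y | isomorphic (M0 X) (M0 Y)].
have clsP X : isomorphic (M0 X) (M0 (cls X)).
  apply: (repP [set Y | isomorphic (M0 X) (M0 Y)]); exists X; exists id.
  by split=> //; exists id.
have clsE X Y : isomorphic (M0 X) (M0 Y) -> cls X = cls Y.
  move=> XY; rewrite /cls; congr rep; apply/seteqP; split=> Z /= h'.
    exact: isomorphic_trans (isomorphic_sym XY) h'.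
  exact: isomorphic_trans XY h'.
(* Skeletons of all models isomorphic to [M0 c] are copied into [M0 c], where equal names force
   equal indices. *)
have /choice[nm nmP] : forall c : set lambda, exists nm : set lambda -> lambda, forall X Y,
    isomorphic (M0 X) (M0 c) -> isomorphic (M0 Y) (M0 c) -> nm X = nm Y -> X = Y.
  move=> c; have [||nm h'] := nmI ('I_n -> M0 c) (@phi_rel L tau n phi (M0 c)).
  - by move=> x y xy yx; apply: (phi_asymmetric _ (KM c)); exists x, y.
  - apply: card_tuples => //; have /card_eqPle[] := K_lambda_card _ (KM c); by [].
  exists nm => X Y Xc Yc; apply: h'.
    by apply: skeleton_isomorphic Xc _; have [] := M0P X.
  by apply: skeleton_isomorphic Yc _; have [] := M0P Y.
(* Each index is named inside the representative of its own class. Isomorphic models share the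
   representative, so among the indices named [l] they have equal indices. *)
have [l [X [Xinj Xl]]] := exists_full_name (fun X => nm (cls X) X) infL.
exists (M0 \o X); split=> [Z|Z Z' ZZ' iso]; first exact: KM.
apply: ZZ'; apply: Xinj; apply: (nmP (cls (X Z))); first exact: clsP.
  by rewrite (clsE _ _ iso); apply: clsP.
by rewrite Xl (clsE _ _ iso) Xl.
Qed.
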